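(* Let $\mathsf q=e^{-\epsilon}$ with $|\mathsf q|<1$, and let $L=a_0(x,\mathsf q)\sigma_{\mathsf q}^2-a_1(x,\mathsf q)\sigma_{\mathsf q}+a_2(x,\mathsf q)$ be a family of second order $\mathsf q$-difference operators with coefficients polynomial in $x$. Let $s\in\mathbb C^\times$ and $r\in\mathbb Z_{\ge0}$ be fixed (independent of $\epsilon$). Assume: (a) $a_0(x,\mathsf q)$ and $a_2(\mathsf q^{-r}x,\mathsf q)$ have a simple zero at $x=s$, there are no other zeroes of $a_0(x,\mathsf q)$ or $a_2(x,\mathsf q)$ of the form $\mathsf q^js$, $j\in\mathbb Z$, and no other zeroes of $a_0(x,\mathsf q)$ or $a_2(x,\mathsf q)$ converge to $s$ as $\epsilon\to0$; (b) $a_0-a_2=O(\epsilon)$ and $a_0+a_2-a_1=O(\epsilon^2)$, and the limits $$\alpha(x)=\lim_{\epsilon\to0}a_0(x,\mathsf q),\quad \beta(x)=\lim_{\epsilon\to0}\epsilon^{-1}\big(a_0(x,\mathsf q)-a_2(x,\mathsf q)\big),\quad \gamma(x)=\lim_{\epsilon\to0}\epsilon^{-2}\big(a_0(x,\mathsf q)+a_2(x,\mathsf q)-a_1(x,\mathsf q)\big)$$ exist as polynomials in $x$. Then $$\lim_{\epsilon\to0}\epsilon^{-2r-2}\Delta_r(s)=\det(-N),$$ where $\Delta_r$ and the $(r+1)\times(r+1)$ matrix $N$ are defined in the context. Hence the condition $\Delta_r(s)=0$ (for all small $\epsilon$) implies $\det N=0$ in the limit.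
   Context: $\sigma_{\mathsf q}$ is the shift operator $(\sigma_{\mathsf q}f)(x)=f(\mathsf qx)$. The degrees in $x$ of the $a_i(x,\mathsf q)$ are bounded independently of $\epsilon$, and limits and $O(\cdot)$ estimates are taken coefficientwise. $\Delta_r(x)$ is the $(r+1)\times(r+1)$ tridiagonal determinant $\Delta_r(x)=\det\big(m_{i,j}(x)\big)_{0\le i,j\le r}$ with $m_{i,i}(x)=a_1(\mathsf q^{-i}x,\mathsf q)$, $m_{i,i+1}(x)=a_2(\mathsf q^{-i}x,\mathsf q)$, $m_{i,i-1}(x)=a_0(\mathsf q^{-i}x,\mathsf q)$, and $m_{i,j}(x)=0$ for $|i-j|>1$. (For $r>0$, $\Delta_r(s)=0$ is the condition for $s,\mathsf q^{-r}s$ to be apparent singularities of $L$.) The limiting differential operator is $\mathcal L=\lim_{\epsilon\to0}\epsilon^{-2}L=\alpha(x)(x\partial)^2-\beta(x)\,x\partial+\gamma(x)$, $\partial=d/dx$. The assumptions on zeroes imply $\alpha(s)=0$, $\beta(s)=rs\,(\partial\alpha)(s)$, $(\partial\alpha)(s)\ne0$, so that $\mathcal Ly=0$ has a regular singularity at $x=s$ with characteristic exponents $0,r+1$. Let $\alpha_j,\beta_j,\gamma_j$ ($j\ge0$) be the Taylor coefficients at $x=s$ (coefficients of $(x-s)^j$) of $x^2\alpha(x)$, $x(\beta(x)-\alpha(x))$, $\gamma(x)$ respectively, and set them equal to $0$ for $j<0$. Then $N=(N_{i,j})_{0\le i,j\le r}$ with $$N_{i,j}=j(j-1)\alpha_{i+2-j}-j\beta_{i+1-j}+\gamma_{i-j}.$$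 The condition $\det N=0$ is the no-log condition: it is equivalent to semi-simplicity of the local monodromy of $\mathcal Ly=0$ at $x=s$. *)

(* Defs.v *)
From mathcomp Require Export all_boot all_order all_algebra.
From mathcomp Require Export complex.
From mathcomp Require Export all_classical all_reals all_analysis.

Set Implicit Arguments.
Unset Strict Implicit.
Unset Printing Implicit Defensive.

Export Order.TTheory GRing.Theory Num.Theory numFieldNormedType.Exports.

#[global] Open Scope classical_set_scope.
#[global] Open Scope ring_scope.

(* The complex numbers over R, packaged so that they carry the topology that
   MathComp-Analysis puts on every numClosedFieldType. *)
Definition Cplx (R : realType) : numClosedFieldType := R[i]%C.

(* e^(a + i b) = e^a (cos b + i sin b) *)
Definition cexp (R : realType) (z : Cplx R) : Cplx R :=
  let: Complex a b := z in Complex (expR a * cos b) (expR a * sin b).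

Definition qexp (R : realType) (e : Cplx R) : Cplx R := cexp (- e).

(* The parameter epsilon tends to 0 inside a set E of admissible values; the
   positive reals and the open right half-plane are both instances. *)
Notation eps_to0 E := (within E (nbhs 0)).

Definition coef_cvg (C : numClosedFieldType) (E : set C)
    (p : C -> {poly C}) (l : {poly C}) : Prop :=
  forall k : nat, (p e)`_k @[e --> eps_to0 E] --> l`_k.

Definition coef_bigO (C : numClosedFieldType) (E : set C)
    (p : C -> {poly C}) (g : C -> C) : Prop :=
  forall k : nat, (fun e => (p e)`_k) =O_ (eps_to0 E) g.

(* [mup x 0 = 0], so this forces p != 0. *)
Definition simple_zero (C : numClosedFieldType) (p : {poly C}) (x : C) : Prop :=
  mup x p = 1%N.

(* Along epsilon -> 0, one can select zeroes z(epsilon) of p(epsilon), different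
   from the distinguished point z0(epsilon), that converge to s. *)
Definition other_zeros_converge (C : numClosedFieldType) (E : set C)
    (p : C -> {poly C}) (z0 : C -> C) (s : C) : Prop :=
  exists z : C -> C,
    (\forall e \near eps_to0 E, root (p e) (z e) /\ z e <> z0 e) /\
    z e @[e --> eps_to0 E] --> s.

(* The operator a0 sigma_q^2 - a1 sigma_q + a2 enters only through the triple of
   its coefficients. *)
Definition Delta (C : numClosedFieldType) (a0 a1 a2 : C -> {poly C})
    (r : nat) (q x : C) : C :=
  \det (\matrix_(i < r.+1, j < r.+1)
    if j == i :> nat then (a1 q).[q ^- i * x]
    else if j == i.+1 :> nat then (a2 q).[q ^- i * x]
    else if i == j.+1 :> nat then (a0 q).[q ^- i * x]
    else 0).

(* Coefficient of ('X - s)^k in p, extended by 0 to k < 0. *)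
Definition taylor (C : numClosedFieldType) (s : C) (p : {poly C}) (k : int) :
    C :=
  match k with
  | Posz n => (p \Po ('X + s%:P))`_n
  | Negz _ => 0
  end.

(* Matrix, on the powers of x - s up to the r-th, of
     alpha (x d/dx)^2 - beta x d/dx + gamma
       = x^2 alpha (d/dx)^2 - x (beta - alpha) d/dx + gamma. *)
Definition Nmx (C : numClosedFieldType) (s : C) (r : nat)
    (alpha beta gamma : {poly C}) : 'M[C]_r.+1 :=
  \matrix_(i < r.+1, j < r.+1)
    (j%:R * (j%:R - 1) * taylor s ('X^2 * alpha) (i%:Z + 2 - j%:Z)
     - j%:R * taylor s ('X * (beta - alpha)) (i%:Z + 1 - j%:Z)
     + taylor s gamma (i%:Z - j%:Z)).

(* Main.v *)
(** Let [x_i = q^-i s].  Since [a0] vanishes at [x_0] and [a2] at [x_r], the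
    tridiagonal matrix acts, up to alternating signs, on the values at
    [x_0, ..., x_r] of a polynomial [g] as minus the q-difference operator
      [T g = a0 g(q x) - a1 g + a2 g(x / q)].
    In the Newton basis [N_j] of these nodes, [Delta] is therefore the
    determinant of minus the matrix of the divided differences of [T N_j] on
    [x_0, ..., x_i].  As [epsilon] goes to 0 the nodes merge at [s], so [N_j]
    tends to [(x - s)^j], [epsilon^-2 T] to the limiting differential operator,
    and divided differences to Taylor coefficients at [s]. *)

Require Import Defs.
From mathcomp Require Import ring lra.

Set Implicit Arguments.
Unset Strict Implicit.
Unset Printing Implicit Defensive.

(** * Newton interpolation and divided differences *)

Section NewtonInterpolation.
Variables (F : fieldType) (x : nat -> F).

(** Iterated division, rather than quotients by differences of nodes, lets the nodes coincide, as
    they do in the limit. *)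
Fixpoint newton_quo (n : nat) (p : {poly F}) : {poly F} :=
  if n is m.+1 then newton_quo m p %/ ('X - (x m)%:P) else p.

(** The divided difference of [p] on the nodes [x 0, ..., x n]. *)
Definition newton_coef (n : nat) (p : {poly F}) : F := (newton_quo n p).[x n].

Definition newton_basis (n : nat) : {poly F} :=
  \prod_(k < n) ('X - (x k)%:P).

Lemma newton_basisS n :
  newton_basis n.+1 = newton_basis n * ('X - (x n)%:P).
Proof. by rewrite /newton_basis big_ord_recr. Qed.

(** Each quotient is divided by the next linear factor; the remainder is its value at the node, the
    next divided difference. *)
Lemma newton_expansion n p :
  p = \sum_(k < n) newton_coef k p *: newton_basis k
      + newton_basis n * newton_quo n p.
Proof.
elim: n => [|n IHn].
  by rewrite big_ord0 add0r /newton_basis big_ord0 mul1r.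
rewrite {1}IHn big_ord_recr /= -addrA; congr (_ + _).
rewrite {1}(divp_eq (newton_quo n p) ('X - (x n)%:P)) modp_XsubC.
by rewrite newton_basisS -mul_polyC /newton_coef; ring.
Qed.

Lemma newton_basis_root i n : (i < n)%N -> (newton_basis n).[x i] = 0.
Proof.
move=> ltin; rewrite /newton_basis horner_prod.
by rewrite (bigD1 (Ordinal ltin)) //= hornerXsubC subrr mul0r.
Qed.

Lemma newton_interpolation n i p : (i < n)%N ->
  p.[x i] = \sum_(k < n) newton_coef k p * (newton_basis k).[x i].
Proof.
move=> ltin; rewrite {1}(newton_expansion n p) hornerD hornerM.
rewrite newton_basis_root // mul0r addr0 horner_sum.
by apply: eq_bigr => k _; rewrite hornerZ.
Qed.

End NewtonInterpolation.

Lemma newton_basis_cst (F : fieldType) (s : F) n :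
  newton_basis (fun=> s) n = ('X - s%:P) ^+ n.
Proof. by rewrite /newton_basis prodr_const card_ord. Qed.

(** With all nodes at [s], translation by [s] turns the Newton expansion into one in powers of ['X],
    with a remainder divisible by ['X^n.+1]. *)
Lemma newton_coef_cst (C : numClosedFieldType) (s : C) n (p : {poly C}) :
  newton_coef (fun=> s) n p = taylor s p n.
Proof.
rewrite /= {2}(newton_expansion (fun=> s) n.+1 p) newton_basis_cst.
have XsK k : ('X - s%:P) ^+ k \Po ('X + s%:P) = 'X^k.
  by rewrite rmorphXn /= comp_polyB comp_polyX comp_polyC addrK.
rewrite comp_polyD comp_polyM XsK mulrC coefD coefMXn ltnSn addr0.
rewrite linear_sum coef_sum /= (bigD1 ord_max) //= big1 => [|k].
  by rewrite newton_basis_cst comp_polyZ XsK coefZ coefXn eqxx mulr1 addr0.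
rewrite -val_eqE /= => neq_kn.
rewrite newton_basis_cst comp_polyZ XsK coefZ coefXn eq_sym.
by rewrite (negPf neq_kn) mulr0.
Qed.

(** * The centred operator $T=L\sigma_q^{-1}$ and the tridiagonal determinant *)

Definition qdiff (C : fieldType) (a0 a1 a2 : {poly C}) (q : C)
    (g : {poly C}) : {poly C} :=
  a0 * (g \Po (q *: 'X)) - a1 * g + a2 * (g \Po (q^-1 *: 'X)).

Lemma qdiffZ (C : fieldType) (c : C) a0 a1 a2 q g :
  qdiff (c *: a0) (c *: a1) (c *: a2) q g = c *: qdiff a0 a1 a2 q g.
Proof. by rewrite /qdiff !scalerDr scalerN -!scalerAl. Qed.

(** The nested tests are mutually exclusive, so the sum splits into three, each picking at most one
    index. *)
Lemma sum_tridiag (V : nmodType) (n : nat) (i : 'I_n) (f : nat -> nat -> V) :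
  \sum_(k < n) (if k == i :> nat then f i k
     else if k == i.+1 :> nat then f i k
     else if i == k.+1 :> nat then f i k else 0)
  = f i i + (if (i.+1 < n)%N then f i i.+1 else 0)
    + (if (0 < i)%N then f i i.-1 else 0).
Proof.
have pick1 (m : nat) : \sum_(k < n) (if k == m :> nat then f i k else 0)
    = if (m < n)%N then f i m else 0.
  case: ltnP => [ltmn|lenm].
    rewrite (bigD1 (Ordinal ltmn)) //= eqxx big1 ?addr0 // => k.
    by rewrite -val_eqE /= => /negPf->.
  by rewrite big1 // => k _; rewrite ltn_eqF // (leq_trans (ltn_ord k)).
rewrite -(pick1 i.+1); have := pick1 i; rewrite ltn_ord => <-.
have -> : (if (0 < i)%N then f i i.-1 else 0) =
    \sum_(k < n) (if i == k.+1 :> nat then f i k else 0).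
  case: i {pick1} => [[|m] ltmn] /=; first by rewrite big1.
  rewrite (bigD1 (Ordinal (ltnW ltmn))) //= eqxx big1 ?addr0 // => k.
  by rewrite -val_eqE /= eqSS eq_sym => /negPf->.
rewrite -!big_split; apply: eq_bigr => k _ /=.
have [->|_] := eqVneq (k : nat) i.
  by rewrite !(ltn_eqF (ltnSn i)) !addr0.
have [->|_] := eqVneq (k : nat) i.+1.
  by rewrite (ltn_eqF (ltnW (ltnSn i.+1))) add0r addr0.
by rewrite !add0r.
Qed.

(* The factors (-1)^i in W absorb the sign of the off-diagonal entries. *)
Lemma Delta_newton (C : numClosedFieldType) (a0 a1 a2 : C -> {poly C})
    (r : nat) (q s : C) (x := fun i => q ^- i * s) :
  q != 0 -> {in gtn r.+1 &, injective x} ->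
  root (a0 q) s -> root (a2 q) (x r) ->
  Delta a0 a1 a2 r q s = \det (- \matrix_(i < r.+1, j < r.+1)
    newton_coef x i (qdiff (a0 q) (a1 q) (a2 q) q (newton_basis x j))).
Proof.
move=> q0 x_inj /eqP a0s /eqP a2s; rewrite /Delta.
set M := (X in \det X); set D := (X in - X).
pose W : 'M[C]_r.+1 := \matrix_(i, k) ((-1) ^+ i * (newton_basis x k).[x i]).
(* [W] is lower triangular; up to sign, its diagonal entries are products of differences of distinct
   nodes. *)
have detW : \det W != 0.
  rewrite det_trig; last first.
    by apply/is_trig_mxP => i j ltij; rewrite mxE newton_basis_root ?mulr0.
  apply/prodf_neq0 => i _; rewrite mxE mulf_neq0 ?signr_eq0 //.
  rewrite /newton_basis horner_prod; apply/prodf_neq0 => k _.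
  rewrite hornerXsubC subr_eq0; apply/eqP => /x_inj.
  by rewrite !inE ltn_ord (ltn_trans (ltn_ord k)) // => /(_ isT isT) /eqP;
    rewrite gtn_eqF.
suff MW : M *m W = W *m - D.
  by apply: (mulIf detW); rewrite -det_mulmx MW det_mulmx mulrC.
have xS i : q^-1 * x i = x i.+1 by rewrite /x mulrA -invfM -exprS.
have xP i : (0 < i)%N -> q * x i = x i.-1.
  by case: i => //= i _; rewrite -xS mulVKf.
apply/matrixP => i j; rewrite !mxE.
pose f (i k : nat) := (if k == i then (a1 q).[x i]
   else if k == i.+1 then (a2 q).[x i] else (a0 q).[x i])
   * ((-1) ^+ k * (newton_basis x j).[x k]).
(* Both products have the entry $(-1)^{i+1}(TN_j)(x_i)$; on the side of [W] times [- D] this is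
   Newton interpolation at a node. *)
transitivity ((-1) ^+ i.+1 *
    (qdiff (a0 q) (a1 q) (a2 q) q (newton_basis x j)).[x i]); last first.
  rewrite (newton_interpolation x _ (ltn_ord i)) mulr_sumr.
  by apply: eq_bigr => k _; rewrite !mxE exprS; ring.
rewrite (eq_bigr (fun k : 'I_r.+1 => if k == i :> nat then f i k
     else if k == i.+1 :> nat then f i k
     else if i == k.+1 :> nat then f i k else 0)); last first.
  move=> k _; rewrite !mxE /f.
  case: (k == i :> nat) => //; case: (k == i.+1 :> nat) => //.
  by case: (i == k.+1 :> nat); rewrite ?mul0r.
rewrite sum_tridiag /f eqxx (gtn_eqF (ltnSn i)) eqxx.
rewrite /qdiff hornerD hornerD hornerN !hornerM !horner_comp !hornerZ !hornerX.
rewrite xS.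
(* In the last row the neighbour [x r.+1] falls outside the matrix; its term drops out because [a2]
   vanishes at [x r]. *)
have -> : (if (i.+1 < r.+1)%N
    then (a2 q).[x i] * ((-1) ^+ i.+1 * (newton_basis x j).[x i.+1]) else 0)
   = (-1) ^+ i.+1 * ((a2 q).[x i] * (newton_basis x j).[x i.+1]).
  case: ltnP => [_|]; first by ring.
  rewrite ltnS => leri.
  have -> : i = r :> nat by apply/eqP; rewrite eqn_leq leri -ltnS ltn_ord.
  by rewrite a2s mul0r mulr0.
case: ltnP => [i_gt0|].
  rewrite xP // (ltn_eqF (_ : i.-1 < i)%N) ?prednK //.
  rewrite (ltn_eqF (_ : i.-1 < i.+1)%N) ?prednK //.
  by rewrite -(prednK i_gt0) !exprS /=; ring.
rewrite leqn0 => /eqP->.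
(* In row 0 the neighbour $qx_0$ is not a node; its term drops out because [a0] vanishes at [x 0],
   which is [s]. *)
have -> : (a0 q).[x 0] = 0 by rewrite /x expr0 invr1 mul1r.
by rewrite expr1 expr0; ring.
Qed.

(** * Coefficientwise limits of polynomials of bounded degree *)

Section CoefficientwiseConvergence.
Variables (C : numClosedFieldType) (T : Type) (F : set_system T).
Hypothesis FF : Filter F.

Lemma cvg_sumC (I : Type) (r : seq I) (f : I -> T -> C) (l : I -> C) :
  (forall i, f i e @[e --> F] --> l i) ->
  \sum_(i <- r) f i e @[e --> F] --> \sum_(i <- r) l i.
Proof.
move=> fl; apply: cvg_big => //.
exact: (@pseudometric_normed_Zmodule.add_continuous _ C).
Qed.

Lemma cvg_prodC (I : Type) (r : seq I) (f : I -> T -> C) (l : I -> C) :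
  (forall i, f i e @[e --> F] --> l i) ->
  \prod_(i <- r) f i e @[e --> F] --> \prod_(i <- r) l i.
Proof. by move=> fl; apply: cvg_big => //; exact: (@mul_continuous C). Qed.

Lemma cvg_expC (f : T -> C) (l : C) n :
  f e @[e --> F] --> l -> f e ^+ n @[e --> F] --> l ^+ n.
Proof.
move=> fl; elim: n => [|n IHn]; first exact: cvg_cst.
by under eq_cvg do rewrite exprS; rewrite exprS; exact: cvgM.
Qed.

Lemma cvg_det n (A : T -> 'M[C]_n) (B : 'M[C]_n) :
  (forall i j, A e i j @[e --> F] --> B i j) ->
  \det (A e) @[e --> F] --> \det B.
Proof.
move=> AB; apply: cvg_sumC => s; apply: cvgM; first exact: cvg_cst.
by apply: cvg_prodC => i; exact: AB.
Qed.

(* The degree bound is what makes evaluation continuous. *)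
Definition poly_cvg (p : T -> {poly C}) (l : {poly C}) :=
  (forall k, (p e)`_k @[e --> F] --> l`_k) /\
  exists d, \forall e \near F, (size (p e) <= d)%N.

Lemma poly_cvg_cst l : poly_cvg (fun=> l) l.
Proof.
by split=> [k|]; [exact: cvg_cst | exists (size l); exact: nearW].
Qed.

Lemma poly_cvgC (x : T -> C) (a : C) :
  x e @[e --> F] --> a -> poly_cvg (fun e => (x e)%:P) a%:P.
Proof.
move=> xa; split=> [k|].
  under eq_cvg do rewrite coefC.
  by rewrite coefC; case: (k == 0%N) => //; exact: cvg_cst.
by exists 1%N; apply: nearW => e; exact: size_polyC_leq1.
Qed.

Lemma poly_cvgD p1 p2 l1 l2 : poly_cvg p1 l1 -> poly_cvg p2 l2 ->
  poly_cvg (fun e => p1 e + p2 e) (l1 + l2).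
Proof.
move=> [p1l [d1 Hd1]] [p2l [d2 Hd2]]; split=> [k|].
  by under eq_cvg do rewrite coefD; rewrite coefD; exact: cvgD.
exists (maxn d1 d2); apply: filterS2 Hd1 Hd2 => e le1 le2.
by rewrite (leq_trans (size_polyD _ _)) // geq_max !leq_max le1 le2 orbT.
Qed.

Lemma poly_cvgM p1 p2 l1 l2 : poly_cvg p1 l1 -> poly_cvg p2 l2 ->
  poly_cvg (fun e => p1 e * p2 e) (l1 * l2).
Proof.
move=> [p1l [d1 Hd1]] [p2l [d2 Hd2]]; split=> [k|].
  under eq_cvg do rewrite coefM; rewrite coefM.
  by apply: cvg_sumC => i; exact: cvgM.
exists (d1 + d2)%N; apply: filterS2 Hd1 Hd2 => e le1 le2.
rewrite (leq_trans (size_polyMleq _ _)) // (leq_trans (leq_pred _)) //.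
exact: leq_add.
Qed.

Lemma poly_cvgN p l : poly_cvg p l -> poly_cvg (fun e => - p e) (- l).
Proof.
move=> [pl [d Hd]]; split=> [k|].
  by under eq_cvg do rewrite coefN; rewrite coefN; exact: cvgN.
by exists d; apply: filterS Hd => e; rewrite size_polyN.
Qed.

Lemma poly_cvgB p1 p2 l1 l2 : poly_cvg p1 l1 -> poly_cvg p2 l2 ->
  poly_cvg (fun e => p1 e - p2 e) (l1 - l2).
Proof. by move=> H1 H2; apply: poly_cvgD => //; exact: poly_cvgN. Qed.

Lemma poly_cvg_prod n (p : nat -> T -> {poly C}) (l : nat -> {poly C}) :
  (forall i, poly_cvg (p i) (l i)) ->
  poly_cvg (fun e => \prod_(i < n) p i e) (\prod_(i < n) l i).
Proof.
move=> pl; elim: n => [|n IHn].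
  have -> : (fun e => \prod_(i < 0) p i e) = fun=> 1.
    by apply/funext => e; rewrite big_ord0.
  by rewrite big_ord0; exact: poly_cvg_cst.
have -> : (fun e => \prod_(i < n.+1) p i e)
    = fun e => (\prod_(i < n) p i e) * p n e.
  by apply/funext => e; rewrite big_ord_recr.
by rewrite big_ord_recr; exact: poly_cvgM.
Qed.

Lemma poly_cvg_horner p l (x : T -> C) a : poly_cvg p l ->
  x e @[e --> F] --> a -> (p e).[x e] @[e --> F] --> l.[a].
Proof.
move=> [pl [d Hd]] xa; pose n := maxn d (size l).
rewrite (@horner_coef_wide _ n) ?leq_maxr //.
have : \sum_(i < n) (p e)`_i * x e ^+ i @[e --> F] -->
    \sum_(i < n) l`_i * a ^+ i.
  by apply: cvg_sumC => i; apply: cvgM => //; exact: cvg_expC.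
apply: cvg_trans; apply: near_eq_cvg; apply: filterS Hd => e le_d /=.
by rewrite (@horner_coef_wide _ n) // leq_max le_d.
Qed.

(** Synthetic division: the constant remainder does not reach the coefficient of index [k.+1]. *)
Lemma coef_divXsubC (K : fieldType) (p : {poly K}) (a : K) k :
  (p %/ ('X - a%:P))`_k = p`_k.+1 + a * (p %/ ('X - a%:P))`_k.+1.
Proof.
rewrite {2}(divp_eq p ('X - a%:P)) modp_XsubC coefD coefC addr0.
by rewrite mulrBr coefB coefMX coefMC mulrC /= subrK.
Qed.

(* Downward induction on the index, by synthetic division. *)
Lemma poly_cvg_divXsubC p l (x : T -> C) (a : C) : poly_cvg p l ->
  x e @[e --> F] --> a ->
  poly_cvg (fun e => p e %/ ('X - (x e)%:P)) (l %/ ('X - a%:P)).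
Proof.
move=> [pl [d Hd]] xa; pose n := maxn d (size l).
have sz (q : {poly C}) (b : C) : (size (q %/ ('X - b%:P))%R <= size q)%N.
  by rewrite size_divp ?polyXsubC_eq0 // leq_subr.
split; last by exists d; apply: filterS Hd => e; exact: leq_trans (sz _ _).
move=> k; elim: {k}(n - k)%N {-2}k (leqnn (n - k)) => [|m IHm] k.
  rewrite leqn0 subn_eq0 geq_max => /andP[ledk lelk].
  rewrite nth_default ?(leq_trans (sz _ _)) //.
  apply: (cvg_trans _ (@cvg_cst C 0 T F _)).
  apply: near_eq_cvg; apply: filterS Hd => e le_d /=.
  by rewrite nth_default // (leq_trans (sz _ _)) // (leq_trans le_d).
move=> lekm; under eq_cvg do rewrite coef_divXsubC.
rewrite coef_divXsubC; apply: cvgD => //; apply: cvgM => //.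
by apply: IHm; rewrite subnS -subn1 leq_subLR add1n.
Qed.

Lemma poly_cvg_newton_basis (x : nat -> T -> C) (a : nat -> C) n :
  (forall i, x i e @[e --> F] --> a i) ->
  poly_cvg (fun e => newton_basis (x ^~ e) n) (newton_basis a n).
Proof.
move=> xa; apply: (@poly_cvg_prod n (fun i e => 'X - (x i e)%:P)
  (fun i => 'X - (a i)%:P)) => i.
by apply: poly_cvgB; [exact: poly_cvg_cst | exact: poly_cvgC].
Qed.

(** Divided differences are jointly continuous in the polynomial and the nodes, even where nodes
    merge, because each division step is. *)
Lemma cvg_newton_coef p l (x : nat -> T -> C) (a : nat -> C) n :
  poly_cvg p l -> (forall i, x i e @[e --> F] --> a i) ->
  newton_coef (x ^~ e) n (p e) @[e --> F] --> newton_coef a n l.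
Proof.
move=> pl xa; apply: poly_cvg_horner => //.
by elim: n => //= n IHn; exact: poly_cvg_divXsubC.
Qed.

End CoefficientwiseConvergence.

(** * Limits of q-difference quotients when $q=1-\epsilon+o(\epsilon)$ *)

Lemma coef_comp_polyZX (C : comNzRingType) (p : {poly C}) (c : C) k :
  (p \Po (c *: 'X))`_k = c ^+ k * p`_k.
Proof.
rewrite comp_polyE coef_sum.
have [ltkp|lepk] := ltnP k (size p); last first.
  rewrite nth_default // mulr0 big1 // => i _.
  rewrite exprZn !coefZ coefXn gtn_eqF ?mulr0 //.
  exact: leq_trans (ltn_ord i) lepk.
rewrite (bigD1 (Ordinal ltkp)) //= big1 ?addr0 => [|i].
  by rewrite exprZn !coefZ coefXn eqxx mulr1 mulrC.
rewrite -val_eqE /= eq_sym => /negPf neq.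
by rewrite exprZn !coefZ coefXn neq !mulr0.
Qed.

Lemma size_comp_polyZX (C : comNzRingType) (p : {poly C}) (c : C) :
  (size (p \Po (c *: 'X))%R <= size p)%N.
Proof.
by apply/leq_sizeP => k lepk; rewrite coef_comp_polyZX nth_default ?mulr0.
Qed.

Section QDerivative.
Variables (C : numClosedFieldType) (T : Type) (F : set_system T).
Hypothesis FF : Filter F.
Variables (eps q : T -> C).
Hypothesis eps0 : eps e @[e --> F] --> 0.
Hypothesis eps_neq0 : \forall e \near F, eps e != 0.
Hypothesis q_deriv : (eps e)^-1 * (q e - 1) @[e --> F] --> (-1 : C).

Lemma cvg_q : q e @[e --> F] --> (1 : C).
Proof.
have : eps e * ((eps e)^-1 * (q e - 1)) + 1 @[e --> F] --> (0 * (-1) + 1 : C).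
  by apply: cvgD; [exact: cvgM | exact: cvg_cst].
rewrite mul0r add0r; apply: cvg_trans; apply: near_eq_cvg.
by apply: filterS eps_neq0 => e e0 /=; rewrite mulVKf // subrK.
Qed.

Lemma q_neq0 : \forall e \near F, q e != 0.
Proof. by apply: cvgr_neq0 cvg_q _; exact: oner_neq0. Qed.

Lemma cvg_qV : (q e)^-1 @[e --> F] --> (1 : C).
Proof.
by rewrite -[X in _ --> X]invr1; apply: cvgV; [exact: oner_neq0 | exact: cvg_q].
Qed.

(** Induction through $q^{k+1}-1=q(q^k-1)+(q-1)$. *)
Lemma cvg_q_power k :
  (eps e)^-1 * (q e ^+ k - 1) @[e --> F] --> (- k%:R : C).
Proof.
elim: k => [|k IHk].
  under eq_cvg do rewrite expr0 subrr mulr0.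
  by rewrite oppr0; exact: cvg_cst.
have -> : (fun e => (eps e)^-1 * (q e ^+ k.+1 - 1)) = fun e =>
    q e * ((eps e)^-1 * (q e ^+ k - 1)) + (eps e)^-1 * (q e - 1).
  by apply/funext => e; rewrite exprS; ring.
rewrite -natr1 opprD -[- k%:R]mul1r.
by apply: cvgD => //; apply: cvgM => //; exact: cvg_q.
Qed.

Lemma cvg_qV_power k :
  (eps e)^-1 * ((q e)^-1 ^+ k - 1) @[e --> F] --> (k%:R : C).
Proof.
have : - ((eps e)^-1 * (q e ^+ k - 1)) * (q e)^-1 ^+ k @[e --> F] -->
    (- (- k%:R) * 1 ^+ k : C).
  apply: cvgM; first by apply: cvgN; exact: cvg_q_power.
  by apply: cvg_expC; exact: cvg_qV.
rewrite opprK expr1n mulr1; apply: cvg_trans; apply: near_eq_cvg.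
apply: filterS q_neq0 => e q0 /=.
have qk0 : q e ^+ k != 0 by rewrite expf_neq0.
rewrite exprVn mulNr -mulrA mulrBl divff // mul1r; ring.
Qed.

(** By $q^k+q^{-k}-2=-(q^k-1)(q^{-k}-1)$, this second-order limit is a product of two first-order
    ones. *)
Lemma cvg_q_power2 k :
  eps e ^- 2 * (q e ^+ k + (q e)^-1 ^+ k - 2) @[e --> F] --> (k%:R ^+ 2 : C).
Proof.
have : - ((eps e)^-1 * (q e ^+ k - 1)) * ((eps e)^-1 * ((q e)^-1 ^+ k - 1))
    @[e --> F] --> (- (- k%:R) * k%:R : C).
  by apply: cvgM; [apply: cvgN; exact: cvg_q_power | exact: cvg_qV_power].
rewrite opprK -expr2; apply: cvg_trans; apply: near_eq_cvg.
apply: filterS q_neq0 => e q0 /=.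
have qk0 : q e ^+ k != 0 by rewrite expf_neq0.
rewrite -exprVn mulNr mulrACA -expr2 -mulrN; congr (_ * _).
by rewrite mulrBl !mulrBr !mulr1 mul1r exprVn divff //; ring.
Qed.

(** The Euler operator $x\,d/dx$, diagonal on monomials like the dilations. *)
Definition theta (g : {poly C}) := 'X * g^`().

Lemma coef_theta g k : (theta g)`_k = k%:R * g`_k.
Proof.
rewrite coefXM; case: k => [|k] /=; first by rewrite mul0r.
by rewrite coef_deriv mulr_natl.
Qed.

Lemma poly_cvg_theta g l : poly_cvg F g l ->
  poly_cvg F (fun e => (eps e)^-1 *: ((g e \Po ((q e)^-1 *: 'X)) - g e))
    (theta l).
Proof.
move=> [gl [d Hd]]; split=> [k|].
  under eq_cvg => e do rewrite coefZ coefB coef_comp_polyZX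
    -{2}[(g e)`_k]mul1r -mulrBl mulrA.
  by rewrite coef_theta; apply: cvgM => //; exact: cvg_qV_power.
exists d; apply: filterS Hd => e le_d.
rewrite (leq_trans (size_scale_leq _ _)) // (leq_trans (size_polyD _ _)) //.
by rewrite size_polyN geq_max (leq_trans (size_comp_polyZX _ _)) le_d.
Qed.

Lemma poly_cvg_theta2 g l : poly_cvg F g l ->
  poly_cvg F (fun e => eps e ^- 2 *: ((g e \Po (q e *: 'X))
     + (g e \Po ((q e)^-1 *: 'X)) - 2%:R *: g e)) (theta (theta l)).
Proof.
move=> [gl [d Hd]]; split=> [k|].
  under eq_cvg => e do rewrite coefZ coefB coefD coefZ !coef_comp_polyZX
    -mulrDl -mulrBl mulrA.
  rewrite !coef_theta mulrA -expr2.
  by apply: cvgM => //; exact: cvg_q_power2.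
exists d; apply: filterS Hd => e le_d.
rewrite (leq_trans (size_scale_leq _ _)) // (leq_trans (size_polyD _ _)) //.
rewrite size_polyN geq_max (leq_trans (size_polyD _ _)) ?geq_max.
  by rewrite (leq_trans (size_scale_leq _ _)).
by rewrite !(leq_trans (size_comp_polyZX _ _)).
Qed.

(** With $g_\pm=g(q^{\pm1}x)$, $Tg=a_0(g_++g_--2g)-(a_0-a_2)(g_--g)+(a_0+a_2-a_1)g$. In the three
    terms, $\epsilon^{-2}$ goes to the second difference, is shared by the two factors, and goes to
    the coefficient. *)
Lemma poly_cvg_qdiff (a0 a1 a2 : T -> {poly C}) (alpha beta gamma : {poly C})
    g l :
  poly_cvg F a0 alpha ->
  poly_cvg F (fun e => (eps e)^-1 *: (a0 e - a2 e)) beta ->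
  poly_cvg F (fun e => eps e ^- 2 *: (a0 e + a2 e - a1 e)) gamma ->
  poly_cvg F g l ->
  poly_cvg F (fun e => eps e ^- 2 *: qdiff (a0 e) (a1 e) (a2 e) (q e) (g e))
    (alpha * theta (theta l) - beta * theta l + gamma * l).
Proof.
move=> Ha Hb Hc Hg.
have := poly_cvgD FF (poly_cvgB FF (poly_cvgM FF Ha (poly_cvg_theta2 Hg))
  (poly_cvgM FF Hb (poly_cvg_theta Hg))) (poly_cvgM FF Hc Hg).
congr poly_cvg; apply/funext => e; rewrite /qdiff.
rewrite -exprVn; set c := (eps e)^-1.
set g1 := g e \Po (q e *: 'X); set g2 := g e \Po ((q e)^-1 *: 'X).
by rewrite -!mul_polyC rmorphXn /=; ring.
Qed.

End QDerivative.

(** * Taylor coefficients at [s] and the entries of [Nmx] *)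

Lemma taylor_mul_XsubC (C : numClosedFieldType) (s : C) (p : {poly C})
    (i k : nat) :
  taylor s (p * ('X - s%:P) ^+ k) i = taylor s p (i%:Z - k%:Z).
Proof.
rewrite /= comp_polyM rmorphXn /= comp_polyB comp_polyX comp_polyC addrK.
rewrite coefMXn; case: ltnP => [ltik|leki]; last by rewrite subzn.
(* A negative index, where [taylor] is 0 by convention. *)
suff -> : i%:Z - k%:Z = Negz (k - i).-1 by [].
by rewrite NegzE prednK ?subn_gt0 // -subzn ?(ltnW ltik) // opprB.
Qed.

Lemma taylorD (C : numClosedFieldType) (s : C) (p q : {poly C}) (i : nat) :
  taylor s (p + q) i = taylor s p i + taylor s q i.
Proof. by rewrite /= comp_polyD coefD. Qed.

Lemma taylorZ (C : numClosedFieldType) (s a : C) (p : {poly C}) (i : nat) :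
  taylor s (a *: p) i = a * taylor s p i.
Proof. by rewrite /= comp_polyZ coefZ. Qed.

(** Since $(x\partial)^2=x^2\partial^2+x\partial$, the operator regroups with coefficients
    $x^2\alpha$, $-x(\beta-\alpha)$ and $\gamma$. *)
Lemma taylor_theta_XsubC (C : numClosedFieldType) (s : C) (r : nat)
    (alpha beta gamma : {poly C}) (i j : 'I_r.+1) :
  let g := ('X - s%:P) ^+ j in
  taylor s (alpha * theta (theta g) - beta * theta g + gamma * g) i
  = Nmx s r alpha beta gamma i j.
Proof.
move=> g; rewrite mxE.
set A := 'X^2 * alpha; set B := 'X * (beta - alpha).
(* Truncation in [j.-1] and [j.-2] is harmless: whenever it occurs, the scalar in front is 0. *)
have -> : alpha * theta (theta g) - beta * theta g + gamma * g =
    (j * j.-1)%:R *: (A * ('X - s%:P) ^+ j.-2)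
    + (- j%:R) *: (B * ('X - s%:P) ^+ j.-1) + gamma * g.
  have dg : g^`() = j%:R *: ('X - s%:P) ^+ j.-1.
    by rewrite deriv_exp derivXsubC mul1r scaler_nat.
  have ddg : g^`()^`() = (j * j.-1)%:R *: ('X - s%:P) ^+ j.-2.
    by rewrite dg derivZ deriv_exp derivXsubC mul1r -[_ *+ j.-1]scaler_nat
      scalerA natrM.
  rewrite !scalerAr scaleNr -dg -ddg mulrN /theta derivM derivX mul1r.
  rewrite /A /B; clear A B dg ddg; clearbody g.
  move: g^`() g^`()^`() => dg ddg; ring.
rewrite !taylorD !taylorZ !taylor_mul_XsubC mulNr.
clearbody A B; clear g; congr (_ - _ + _).
- case: (nat_of_ord j) => [|[|k]]; first by rewrite mul0n mulr0n !mul0r.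
    by rewrite muln0 mulr0n subrr mulr0 !mul0r.
  rewrite natrM -[k.+2%:R]natr1 addrK; congr (_ * taylor _ _ _).
  by rewrite /= -[k.+2]addn2 PoszD; ring.
- case: (nat_of_ord j) => [|k]; first by rewrite mulr0n !mul0r.
  by congr (_ * taylor _ _ _); rewrite /= -[k.+1]addn1 PoszD; ring.
Qed.

(** * The limit of the rescaled determinant *)

Lemma DeltaZ (C : numClosedFieldType) (a0 a1 a2 : C -> {poly C})
    (r : nat) (q x c : C) :
  Delta (fun p => c *: a0 p) (fun p => c *: a1 p) (fun p => c *: a2 p) r q x
  = c ^+ r.+1 * Delta a0 a1 a2 r q x.
Proof.
rewrite /Delta -detZ; congr (\det _); apply/matrixP => i j; rewrite !mxE.
by rewrite !hornerZ; do 3!case: ifP => // _; rewrite mulr0.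
Qed.

Lemma cvg_Delta (C : numClosedFieldType) (T : Type) (F : set_system T)
    (FF : Filter F) (eps q : T -> C) (a0 a1 a2 : C -> {poly C}) (s : C)
    (r : nat) (alpha beta gamma : {poly C}) :
  eps e @[e --> F] --> 0 ->
  (\forall e \near F, eps e != 0) ->
  (eps e)^-1 * (q e - 1) @[e --> F] --> (-1 : C) ->
  (\forall e \near F, {in gtn r.+1 &, injective (fun i => q e ^- i * s)}) ->
  (\forall e \near F, root (a0 (q e)) s) ->
  (\forall e \near F, root (a2 (q e)) (q e ^- r * s)) ->
  poly_cvg F (fun e => a0 (q e)) alpha ->
  poly_cvg F (fun e => (eps e)^-1 *: (a0 (q e) - a2 (q e))) beta ->
  poly_cvg F (fun e => eps e ^- 2 *: (a0 (q e) + a2 (q e) - a1 (q e))) gamma ->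
  eps e ^- (2 * r + 2) * Delta a0 a1 a2 r (q e) s @[e --> F]
    --> \det (- Nmx s r alpha beta gamma).
Proof.
move=> e0 en0 qd inj ra0 ra2 ca cb cc.
pose x i e := q e ^- i * s.
have xs i : x i e @[e --> F] --> s.
  rewrite -[X in _ --> X]mul1r; apply: cvgM; last exact: cvg_cst.
  under eq_cvg do rewrite -exprVn.
  by rewrite -(expr1n _ i); apply: cvg_expC; exact: (cvg_qV FF e0 en0 qd).
pose D e : 'M[C]_r.+1 := \matrix_(i, j) newton_coef (x ^~ e) i
  (eps e ^- 2 *: qdiff (a0 (q e)) (a1 (q e)) (a2 (q e)) (q e)
     (newton_basis (x ^~ e) j)).
have : \det (- D e) @[e --> F] --> \det (- Nmx s r alpha beta gamma).
  apply: cvg_det => i j.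
  under eq_cvg do rewrite !mxE.
  rewrite [(- Nmx _ _ _ _ _) i j]mxE; apply: cvgN.
  (* The entry of [Nmx] becomes a divided difference on nodes all equal to [s], the limit of the one
     on the moving nodes. *)
  rewrite -taylor_theta_XsubC -newton_coef_cst -newton_basis_cst.
  apply: cvg_newton_coef => //.
  apply: poly_cvg_qdiff => //.
  exact: poly_cvg_newton_basis.
apply: cvg_trans; apply: near_eq_cvg.
near=> e => /=.
(* One factor $\epsilon^{-2}$ per row, which [DeltaZ] moves into the coefficients. *)
rewrite (_ : eps e ^- (2 * r + 2) = (eps e ^- 2) ^+ r.+1); last first.
  by rewrite exprVn -exprM mulnS addnC.
rewrite -DeltaZ Delta_newton; last 1 first.
- by rewrite /root hornerZ mulf_eq0; apply/orP; right; near: e.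
- congr (\det (- _)); apply/matrixP => i j; rewrite !mxE.
  by rewrite qdiffZ.
- by near: e; exact: (q_neq0 FF e0 en0 qd).
- by near: e.
- by rewrite /root hornerZ mulf_eq0; apply/orP; right; near: e.
Unshelve. all: by end_near.
Qed.

(** * First-order behaviour of the complex exponential at 0 *)

Lemma is_derive0_le (R : realType) (f : R -> R) (l : R) :
  is_derive (0 : R) (1 : R) f l ->
  forall eta : R, 0 < eta ->
  exists2 d : R, 0 < d &
    forall x, `|x| < d -> `|f x - f 0 - l * x| <= eta * `|x|.
Proof.
move=> df eta eta0.
have := ex_derive (is_derive := df).
move=> /(@cvgr_dist_lt _ _ _ _ _ _ _) /(_ _ eta0).
rewrite -/(derive f 0 1) derive_val => /nbhs_ballP[d /= d0 Hd].
exists d => // x xd.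
(* The difference quotient is controlled only on a punctured neighbourhood. *)
have [->|x0] := eqVneq x 0; first by rewrite mulr0 !subrr normr0 mulr0.
have := Hd x; rewrite /ball /= sub0r normrN => /(_ xd x0) /ltW.
rewrite addr0 [_ *: 1]mulr1 => Hx.
rewrite -ler_pdivrMr ?normr_gt0 // -normfV -normrM distrC in Hx *.
by apply: le_trans Hx; rewrite mulrBl mulfK // [x^-1 *: _]mulrC distrC.
Qed.

Lemma sqrt_sqrD_le (R : rcfType) (u v : R) :
  Num.sqrt (u ^+ 2 + v ^+ 2) <= `|u| + `|v|.
Proof.
rewrite -[leRHS]ger0_norm ?addr_ge0 // -[leRHS]sqrtr_sqr ler_wsqrtr //.
rewrite sqrrD !real_normK ?num_real // addrAC lerDl.
by rewrite mulrn_wge0 // mulr_ge0.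
Qed.

(** The derivatives of the real exp, cos and sin at 0 bound the real part [U] and the imaginary part
    [V] of the error. *)
Lemma cexp_first_order (R : realType) (eta : R) : 0 < eta ->
  \forall z \near (0 : Cplx R), `|cexp z - 1 - z| <= eta%:C%C * `|z|.
Proof.
move=> eta0.
(* The bounds on [U] and [V] have constants 3 and 5, whence the 8; [h <= 1] bounds $|1+a|$ by 2 and
   $|e^a|$ by 3. *)
have [h [h0 h1 h8]] : exists h : R, [/\ 0 < h, h <= 1 & 8 * h <= eta].
  exists (Num.min (eta / 8) 1); split.
  - by rewrite lt_min divr_gt0 // ltr01.
  - by rewrite ge_min lexx orbT.
  - by rewrite mulrC -ler_pdivlMr // ge_min lexx.
have [d1 d10 He] := is_derive0_le (@is_derive_expR R 0) h0.
have [d2 d20 Hc] := is_derive0_le (@is_derive_cos R 0) h0.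
have [d3 d30 Hs] := is_derive0_le (@is_derive_sin R 0) h0.
(* Putting [h] in the minimum gives $|a|<h$, hence $|e^a-1|\le 2h$, so that $(e^a-1)b$ is of order
   [h * m]. *)
pose d := Num.min (Num.min d1 d2) (Num.min d3 h).
have d0 : 0 < (d%:C%C : Cplx R) by rewrite ltcR /d !lt_min d10 d20 d30 h0.
apply: filterS (@nbhs0_lt (Cplx R) (Cplx R) _ d0) => -[a b].
rewrite !normc_def /= ltcR.
set m := Num.sqrt (a ^+ 2 + b ^+ 2) => md.
have am : `|a| <= m by rewrite -sqrtr_sqr ler_wsqrtr // lerDl sqr_ge0.
have bm : `|b| <= m by rewrite -sqrtr_sqr ler_wsqrtr // lerDr sqr_ge0.
have [ad bd] := (le_lt_trans am md, le_lt_trans bm md).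
move: ad bd; rewrite !lt_min => /andP[/andP[ad1 _] /andP[_ ah]].
move=> /andP[/andP[_ bd2] /andP[bd3 bh]].
have := He _ ad1; rewrite expR0 mul1r => {}He.
have := Hc _ bd2; rewrite cos0 sin0 oppr0 mul0r subr0 => {}Hc.
have := Hs _ bd3; rewrite sin0 cos0 subr0 mul1r => {}Hs.
rewrite -rmorphM /= lecR addr0.
set U := (X in X ^+ 2 + _); set V := (X in _ + X ^+ 2).
apply: le_trans (sqrt_sqrD_le U V) _.
have m0 : 0 <= m by exact: sqrtr_ge0.
have a1 : `|1 + a| <= 2.
  by rewrite (le_trans (ler_normD _ _)) // normr1; lra.
have eb : `|expR a - 1| <= 2 * h.
  rewrite (_ : expR a - 1 = (expR a - 1 - a) + a); last by ring.
  rewrite (le_trans (ler_normD _ _)) //.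
  have : h * `|a| <= 1 * `|a| by rewrite ler_wpM2r.
  by move: He; lra.
have e3 : `|expR a| <= 3.
  rewrite (_ : expR a = (expR a - 1) + 1); last by ring.
  by rewrite (le_trans (ler_normD _ _)) // normr1; lra.
have hm0 : 0 <= h * m by rewrite mulr_ge0 // ltW.
have ham : h * `|a| <= h * m by rewrite ler_wpM2l // ltW.
have hbm : h * `|b| <= h * m by rewrite ler_wpM2l // ltW.
have U3 : `|U| <= 3 * (h * m).
  have -> : U = (expR a - 1 - a) * cos b + (1 + a) * (cos b - 1).
    by rewrite /U; ring.
  rewrite (le_trans (ler_normD _ _)) // !normrM.
  have : `|expR a - 1 - a| * `|cos b| <= h * m * 1.
    apply: ler_pM => //; first exact: le_trans He ham.
    by rewrite ler_norml cos_geN1 cos_le1.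
  have : `|1 + a| * `|cos b - 1| <= 2 * (h * m).
    by apply: ler_pM => //; exact: le_trans Hc hbm.
  by lra.
have V5 : `|V| <= 5 * (h * m).
  rewrite (_ : V = expR a * (sin b - b) + (expR a - 1) * b); last first.
    by rewrite /V; ring.
  rewrite (le_trans (ler_normD _ _)) // !normrM.
  have : `|expR a| * `|sin b - b| <= 3 * (h * m).
    by apply: ler_pM => //; exact: le_trans Hs hbm.
  have : `|expR a - 1| * `|b| <= 2 * h * m by exact: ler_pM.
  by lra.
have : 8 * h * m <= eta * m by rewrite ler_wpM2r.
by lra.
Qed.

Lemma cvg_qexp (R : realType) (E : set (Cplx R)) : ~ E 0 ->
  e^-1 * (qexp e - 1) @[e --> eps_to0 E] --> (-1 : Cplx R).
Proof.
move=> E0; apply/cvgrPdist_le => -[er ei].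
(* In the order on complex numbers a positive tolerance has imaginary part 0. *)
rewrite ltcE /= => /andP[/eqP-> er0].
have [d d0 Hd] := (@nbhs_ballP _ _ _ _).1 (cexp_first_order er0).
rewrite near_withinE.
apply: filterS (@nbhs0_lt (Cplx R) (Cplx R) _ d0) => e ed Ee.
have e0 : e != 0 by apply/eqP => e0; rewrite e0 in Ee.
have : ball (0 : Cplx R) d (- e).
  by rewrite -ball_normE /ball_ /= sub0r opprK.
move=> /Hd /=; rewrite -/(qexp e) normrN => He.
rewrite (_ : -1 - _ = - (e^-1 * (qexp e - 1 - - e))); last first.
  by rewrite opprK [in RHS]mulrDr mulVf // opprD addrC.
by rewrite normrN normrM normfV mulrC ler_pdivrMr ?normr_gt0.
Qed.

(** * From the hypotheses of the theorem to the limit *)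

Lemma simple_zero_root (C : numClosedFieldType) (p : {poly C}) (x : C) :
  simple_zero p x -> root p x.
Proof. by move=> mu1; apply: contraT => /mupNroot; rewrite mu1. Qed.


Theorem propositionA1 (R : realType) (E : set (Cplx R))
    (a0 a1 a2 : Cplx R -> {poly (Cplx R)}) (s : Cplx R) (r : nat)
    (alpha beta gamma : {poly (Cplx R)})
    (hE : closure E 0)
    (hq : forall e, E e -> `|qexp e| < 1)
    (hdeg : exists d : nat, forall e, E e ->
      [/\ (size (a0 (qexp e)) <= d)%N, (size (a1 (qexp e)) <= d)%N
        & (size (a2 (qexp e)) <= d)%N])
    (hs : s != 0)
    (ha0 : forall e, E e -> simple_zero (a0 (qexp e)) s)
    (ha2 : forall e, E e ->
      simple_zero (a2 (qexp e) \Po (qexp e ^- r *: 'X)) s)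
    (ha0q : forall e, E e -> forall j : int,
      root (a0 (qexp e)) (qexp e ^ j * s) -> qexp e ^ j * s = s)
    (ha2q : forall e, E e -> forall j : int,
      root (a2 (qexp e)) (qexp e ^ j * s) -> qexp e ^ j * s = qexp e ^- r * s)
    (ha0s : ~ other_zeros_converge E (fun e => a0 (qexp e)) (fun _ => s) s)
    (ha2s : ~ other_zeros_converge E (fun e => a2 (qexp e))
                (fun e => qexp e ^- r * s) s)
    (hO1 : coef_bigO E (fun e => a0 (qexp e) - a2 (qexp e)) (fun e => e))
    (hO2 : coef_bigO E (fun e => a0 (qexp e) + a2 (qexp e) - a1 (qexp e))
             (fun e => e ^+ 2))
    (halpha : coef_cvg E (fun e => a0 (qexp e)) alpha)
    (hbeta : coef_cvg E (fun e => e^-1 *: (a0 (qexp e) - a2 (qexp e))) beta)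
    (hgamma : coef_cvg E
       (fun e => e ^- 2 *: (a0 (qexp e) + a2 (qexp e) - a1 (qexp e))) gamma) :
  (e ^- (2 * r + 2) * Delta a0 a1 a2 r (qexp e) s @[e --> eps_to0 E]
     --> \det (- Nmx s r alpha beta gamma)) /\
  ((\forall e \near eps_to0 E, Delta a0 a1 a2 r (qexp e) s = 0) ->
     \det (Nmx s r alpha beta gamma) = 0).
Proof.
(* At $\epsilon=0$ one has $q=1$, against $|q|<1$ on [E]. *)
have E0 : ~ E 0.
  move=> /hq; rewrite /qexp oppr0 /= expR0 cos0 sin0 mulr1 mulr0.
  by rewrite -[(1 +i* 0)%C]/(1 : Cplx R) normr1 ltxx.
have q_cvg := cvg_qexp E0.
have e_cvg : e @[e --> eps_to0 E] --> (0 : Cplx R) by exact: cvg_within.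
have nearE : \forall e \near eps_to0 E, E e by exact: near_withinT.
have e_neq0 : \forall e \near eps_to0 E, e != 0.
  by apply: filterS nearE => e Ee; apply/eqP => e0; rewrite e0 in Ee.
have pcvg p l d : coef_cvg E p l -> (forall e, E e -> (size (p e) <= d)%N) ->
    poly_cvg (eps_to0 E) p l.
  by move=> pl pd; split => //; exists d; apply: filterS nearE.
have [d Hd] := hdeg.
have main : e ^- (2 * r + 2) * Delta a0 a1 a2 r (qexp e) s @[e --> eps_to0 E]
    --> \det (- Nmx s r alpha beta gamma).
  apply: (@cvg_Delta (Cplx R) (Cplx R) (eps_to0 E) _ id (@qexp R) a0 a1 a2
    s r alpha beta gamma e_cvg e_neq0 q_cvg).
  (* The nodes $q^{-i}s$ have distinct moduli, as $s\ne0$ and $0<|q|<1$. *)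
  - apply: filterS2 nearE (q_neq0 _ e_cvg e_neq0 q_cvg) => e Ee q0 i j _ _.
    move=> /(mulIf hs) /invr_inj /(congr1 Num.norm); rewrite !normrX.
    apply: ieexprIn; first by rewrite normr_gt0.
    by rewrite lt_eqF ?hq.
  - by apply: filterS nearE => e Ee; apply: simple_zero_root; exact: ha0.
  - apply: filterS nearE => e Ee; have := simple_zero_root (ha2 e Ee).
    by rewrite root_comp hornerZ hornerX.
  - by apply: (pcvg _ _ d) => // e /Hd[].
  - apply: (pcvg _ _ d) => // e /Hd[s0 s1 s2].
    rewrite (leq_trans (size_scale_leq _ _)) // (leq_trans (size_polyD _ _)) //.
    by rewrite size_polyN geq_max s0.
  - apply: (pcvg _ _ d) => // e /Hd[s0 s1 s2].
    rewrite (leq_trans (size_scale_leq _ _)) // (leq_trans (size_polyD _ _)) //.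
    by rewrite size_polyN geq_max s1 (leq_trans (size_polyD _ _)) // geq_max s0.
(* As 0 lies in the closure of [E], the filter is proper and limits along it are unique. *)
split=> // Delta0; have := within_nbhs_proper hE => FF.
have : e ^- (2 * r + 2) * Delta a0 a1 a2 r (qexp e) s @[e --> eps_to0 E]
    --> (0 : Cplx R).
  apply: (cvg_trans _ (@cvg_cst (Cplx R) 0 _ (eps_to0 E) _)).
  by apply: near_eq_cvg; apply: filterS Delta0 => e De; rewrite De mulr0.
move=> /(cvg_unique (@norm_hausdorff _ (Cplx R)) main) /eqP.
rewrite -scaleN1r detZ mulf_eq0 signr_eq0.
by move=> /eqP.
Qed.
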